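(* Let $G$ be a finite non-abelian group, let $H$ be a subgroup of $G$ with $H \neq Z(H,G)$ and $|H| \neq 2$, and let $g \in K(H,G)$. If $g \neq 1$, then $\Gamma_{H,G}^g$ is not a tree.
   Context: For $x,y$ in a group, $[x,y] = x^{-1}y^{-1}xy$. For a subgroup $H$ of $G$: $Z(H,G) = \{x \in H : xy = yx \text{ for all } y \in G\}$ and $K(H,G) = \{[x,y] : x \in H,\ y \in G\}$. The relative $g$-noncommuting graph $\Gamma_{H,G}^g$ is the simple undirected graph with vertex set $G$ in which two distinct vertices $x,y$ are adjacent if and only if ($x \in H$ or $y \in H$) and $[x,y] \neq g$ and $[x,y] \neq g^{-1}$. *)

(* Defs.v *)
From mathcomp Require Import all_boot all_fingroup.

Set Implicit Arguments.
Unset Strict Implicit.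
Unset Printing Implicit Defensive.

Local Open Scope group_scope.

(* Simple undirected graphs whose vertices form a subset of T. *)
Record sgraph (T : finType) := SGraph {
  vertices : {set T};
  adj : rel T;
  adj_sym : symmetric adj;
  adj_irrefl : irreflexive adj;
  adj_vertices : forall x y, adj x y -> x \in vertices
}.

Section Trees.
Variables (T : finType) (X : sgraph T).

(* Paths between vertices never leave [vertices X], by [adj_vertices]. *)
Definition is_connected : Prop :=
  vertices X != set0 /\ {in vertices X &, forall x y, connect (adj X) x y}.

(* The size bound excludes the empty cycle and x - y - x, which [ucycle]
   accepts. *)
Definition is_acyclic : Prop :=
  forall c : seq T, 2 < size c -> ~ ucycle (adj X) c.

Definition is_tree : Prop := is_connected /\ is_acyclic.
End Trees.

Section RelNoncommutingGraph.
Variables (gT : finGroupType) (H G : {group gT}) (g : gT).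

Definition rel_nc_adj : rel gT := fun x y =>
  [&& x \in G, y \in G, x != y, (x \in H) || (y \in H),
      [~ x, y] != g & [~ x, y] != g^-1].

Lemma rel_nc_adj_sym : symmetric rel_nc_adj.
Proof.
move=> x y; rewrite /rel_nc_adj -(invg_comm y x) !(can2_eq invgK invgK) invgK.
rewrite (eq_sym x) orbC [in LHS](andbC (_ != g^-1)).
by do 2![case: (_ \in G) => //=].
Qed.

Lemma rel_nc_adj_irrefl : irreflexive rel_nc_adj.
Proof. by move=> x; rewrite /rel_nc_adj eqxx !andbF. Qed.

Lemma rel_nc_adj_vertices x y : rel_nc_adj x y -> x \in G.
Proof. by case/and3P. Qed.

Definition rel_nc_graph : sgraph gT :=
  SGraph rel_nc_adj_sym rel_nc_adj_irrefl rel_nc_adj_vertices.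
End RelNoncommutingGraph.

(* Main.v *)
Require Import Defs.
From mathcomp Require Import all_boot all_fingroup.

Local Open Scope group_scope.

(** Commuting elements have commutator [1], which differs from both [g] and
    [g^-1] as soon as [g != 1]; hence distinct commuting elements of [H] are
    always adjacent ([commuting_rel_nc_adj]), and two distinct commuting elements
    of [H^#] form a triangle with [1]. Such a pair exists in every group of order
    at least 3 ([ex_commuting_pair]). The group [H] has such an order, because
    the trivial group is central in [G] and order 2 is excluded. *)

(** If some element has nontrivial square, it can be paired with its inverse;
    otherwise the group has exponent 2, so it is abelian and any two nontrivial
    elements will do. *)
Lemma ex_commuting_pair (gT : finGroupType) (H : {group gT}) :
  2 < #|H| ->
  exists x y, [/\ x \in H^#, y \in H^#, x != y & commute x y].
Proof.
move=> H_gt2.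
have [/exists_inP[x xH x2] | /exists_inPn invH] :=
  boolP [exists x in H, x ^+ 2 != 1].
  have x1 : x != 1 by apply: contraNneq x2 => ->; rewrite expg1n.
  exists x, x^-1; split; last exact: commuteV.
  - by rewrite !inE x1.
  - by rewrite !inE invg_eq1 x1 groupV.
  - by apply: contraNneq x2 => xV; rewrite expgS expg1 {2}xV mulgV.
have invE z : z \in H -> z^-1 = z.
  by move=> /invH/negPn/eqP z2; apply/eqP; rewrite eq_invg_mul -z2.
have /card_gt1P[x [y [xH yH xy]]] : 1 < #|H^#|.
  by rewrite (cardsD1 1) group1 in H_gt2.
exists x, y; split=> //.
have [/setD1P[_ {}xH] /setD1P[_ {}yH]] := (xH, yH).
(* In exponent 2, inverting the product reverses it. *)
by rewrite /commute -(invE (x * y)) ?groupM // invMg !invE.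
Qed.

Lemma commuting_rel_nc_adj (gT : finGroupType) (H G : {group gT}) (g x y : gT) :
  H \subset G -> g != 1 -> x \in H -> y \in H -> x != y -> commute x y ->
  rel_nc_adj H G g x y.
Proof.
move=> /subsetP sHG g1 xH yH xy /commgP/eqP cxy.
by rewrite /rel_nc_adj !sHG // xy xH cxy !(eq_sym 1) invg_eq1 g1.
Qed.

Theorem theorem2p5 (gT : finGroupType) (G H : {group gT}) (g : gT)
    (nonabelG : ~~ abelian G) (sHG : H \subset G)
    (HneqZ : H :!=: 'C_H(G)) (cardH : #|H| != 2)
    (gK : g \in commg_set H G) (g_neq1 : g != 1) :
  ~ is_tree (rel_nc_graph H G g).
Proof.
have H_gt2 : 2 < #|H|.
  rewrite ltn_neqAle eq_sym cardH cardG_gt1.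
  by apply: contraNneq HneqZ => ->; rewrite (setIidPl (sub1G _)).
have [x [y [/setD1P[x1 xH] /setD1P[y1 yH] xy cxy]]] := ex_commuting_pair _ _ H_gt2.
move=> [_ /(_ [:: 1; x; y] isT)]; apply.
have adjC := commuting_rel_nc_adj _ _ _ _ _ _ sHG g_neq1.
apply/andP; split; rewrite /= ?inE ?negb_or ?(eq_sym 1) ?x1 ?y1 ?xy //.
have c1 (z : gT) : commute 1 z by apply/commute_sym/commute1.
by rewrite !adjC ?group1 // 1?eq_sym //; apply: commute1.
Qed.
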